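(* Let $X$ be an infinite-dimensional complex Banach space and let $A, B \in \mathcal{B}(X)$ be linearly independent rank one operators. Then the following are equivalent. (i) $A \sim B$. (ii) There exists $R \in \mathcal{F}_1(X)$ such that $R$ and $A$ are linearly independent, $R$ and $B$ are linearly independent, and for every $T \in \mathcal{B}(X)$, $\dim F(AT) = \dim F(BT) = 1$ implies $\dim F(RT) = 1$.
   Context: $\mathcal{B}(X)$ is the algebra of all bounded linear operators on $X$, and $X^*$ is the dual space of $X$. For $x \in X$ and $f \in X^*$, $x \otimes f \in \mathcal{B}(X)$ is the operator of rank at most one defined by $(x \otimes f)z = f(z)x$ for $z \in X$. $\mathcal{F}_1(X)$ is the set of all operators in $\mathcal{B}(X)$ of rank at most one. For $T \in \mathcal{B}(X)$, $F(T) = \{x \in X : Tx = x\}$ is the subspace of fixed points of $T$, and $\dim F(T)$ is its dimension. For $x, y \in X$ and $f, g \in X^*$, one writes $x \otimes f \sim y \otimes g$ if $x$ and $y$ are linearly dependent or $f$ and $g$ are linearly dependent. *)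

(* Defs.v *)
From HB Require Import structures.
From mathcomp Require Import all_boot all_order all_algebra.
From mathcomp Require Export complex.
From mathcomp Require Import all_classical all_reals all_analysis.
Set Implicit Arguments.
Unset Strict Implicit.
Unset Printing Implicit Defensive.
Import Order.TTheory GRing.Theory Num.Theory.
Import numFieldNormedType.Exports.
Local Open Scope classical_set_scope.
Local Open Scope ring_scope.

(* Linear algebra in a module that need not be finite-dimensional, so that
   [free], [span] and [\dim] of vector.v, which need a vectType, do not apply. *)
Section Dimension.
Variables (K : fieldType) (V : lmodType K).

Definition lin_indep n (e : n.-tuple V) : Prop :=
  forall a : 'I_n -> K, \sum_(i < n) a i *: e`_i = 0 -> forall i, a i = 0.

Definition lin_dep n (e : n.-tuple V) : Prop := ~ lin_indep e.

Definition lin_span n (e : n.-tuple V) : set V :=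
  [set v | exists a : 'I_n -> K, v = \sum_(i < n) a i *: e`_i].

Definition has_dim (S : set V) (n : nat) : Prop :=
  exists e : n.-tuple V, lin_indep e /\ S = lin_span e.

End Dimension.

Definition infinite_dimensional (K : fieldType) (V : lmodType K) : Prop :=
  ~ exists n, has_dim [set: V] n.

Section BoundedLinear.
Variables (K : numFieldType) (V W : normedModType K).

Definition bounded_linear : {pred V -> W} :=
  [pred f | `[< linear f /\ exists M : K, forall x, `|f x| <= M * `|x| >]].

Lemma bounded_linearP (f : V -> W) :
  f \in bounded_linear <->
  linear f /\ exists M : K, forall x, `|f x| <= M * `|x|.
Proof. by split => [/asboolP|/asboolP]. Qed.

Fact bounded_linear_submod : submod_closed bounded_linear.
Proof.
split=> [|a f g /bounded_linearP[lf [M fM]] /bounded_linearP[lg [N gN]]].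
  apply/bounded_linearP; split => [b x y|]; first by rewrite [RHS]addr0 scaler0.
  by exists 0 => x; rewrite [`|_|]normr0 mul0r.
apply/bounded_linearP; split => [b x y|].
  rewrite !fctE lf lg !scalerDr !scalerA (mulrC b) -!addrA; congr (_ + _).
  by rewrite addrCA.
exists (`|a| * M + N) => x; rewrite !fctE mulrDl (le_trans (ler_normD _ _))//.
by rewrite lerD// normrZ -mulrA ler_wpM2l.
Qed.

HB.instance Definition _ := GRing.isSubmodClosed.Build K (V -> W) bounded_linear
  bounded_linear_submod.

Record boundedLinear := BoundedLinear {
  bl_fun :> V -> W;
  bl_funP : bl_fun \in bounded_linear }.

HB.instance Definition _ := [isSub for bl_fun].
HB.instance Definition _ := [Choice of boundedLinear by <:].
HB.instance Definition _ := [SubChoice_isSubLmodule of boundedLinear by <:].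

Fact bl_fun_is_linear (f : boundedLinear) : linear f.
Proof. by case/bounded_linearP: (bl_funP f). Qed.

HB.instance Definition _ (f : boundedLinear) :=
  GRing.isLinear.Build K V W *:%R f (bl_fun_is_linear f).

End BoundedLinear.

Notation "''B' ( X )" := (boundedLinear X X) (format "''B' ( X )") : type_scope.

Definition dual (K : numFieldType) (X : normedModType K) :=
  boundedLinear X K^o.

Section Operators.
Variables (K : numFieldType) (X : normedModType K).
Implicit Types (A B T : 'B(X)) (x y : X) (f g : dual X).

Fact opcomp_subproof A B : A \o B \in @bounded_linear K X X.
Proof.
apply/bounded_linearP; split => [a x y|]; first by rewrite /= !linearP.
have /bounded_linearP[_ [M AM]] := bl_funP A.
have /bounded_linearP[_ [N BN]] := bl_funP B.
exists (`|M| * N) => x /=; apply: (le_trans (AM _)).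
have [->|Bx0] := eqVneq (B x) 0.
  by rewrite normr0 mulr0 -mulrA mulr_ge0// (le_trans _ (BN x)).
have M0 : 0 <= M.
  by rewrite -(pmulr_lge0 M (_ : 0 < `|B x|)) ?normr_gt0// (le_trans _ (AM _)).
by rewrite ger0_norm// -mulrA ler_wpM2l.
Qed.

Definition opcomp A B : 'B(X) := BoundedLinear (opcomp_subproof A B).

Fact tensor_subproof x f :
  (fun z => (f z : K) *: x) \in @bounded_linear K X X.
Proof.
apply/bounded_linearP; split => [a y z|].
  by rewrite linearP scalerDl scalerA.
have /bounded_linearP[_ [M fM]] := bl_funP f.
exists (M * `|x|) => z; rewrite normrZ mulrAC.
by rewrite ler_wpM2r.
Qed.

Definition tensor x f : 'B(X) := BoundedLinear (tensor_subproof x f).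

Definition has_rank A (n : nat) : Prop := has_dim (range A) n.

Definition rank_le1 : set 'B(X) :=
  [set A | exists2 n, (n <= 1)%N & has_rank A n].

Definition fixed_space T : set X := [set x | T x = x].

(* The relation is given on expressions [x (x) f] and carried over to operators
   through their representations; since [x] and [f] are unique up to mutually
   inverse scalars when the operator is nonzero, and one of them is 0 otherwise,
   the choice of representations is immaterial. *)
Definition op_sim A B : Prop :=
  exists x f y g,
    [/\ A = tensor x f, B = tensor y g &
        lin_dep [tuple x; y] \/ lin_dep [tuple f; g]].

End Operators.

(* Main.v *)
(* For rank one operators A = x (x) f and R = u (x) h, dim F(AT) = 1 means
   f(Tx) = 1. If A ~ B, then A and B share a factor and R = (A + B)/2 works.
   Conversely, if f and g are independent then the condition on R says that
   T |-> h(Tu) is 1 wherever T |-> f(Tx) and T |-> g(Ty) are both 1; testing it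
   on operators w (x) theta gives R = aA + bB, where a, b <> 0 since R is
   independent of A and of B. If x and y were independent as well, R would have
   rank two.

   The test functionals theta are provided by the Hahn-Banach theorem, obtained
   here by observing that a pointwise minimal sublinear functional is linear,
   which avoids extending partially defined functionals. *)
Require Import Defs.
From HB Require Import structures.
From mathcomp Require Import all_boot all_order all_algebra.
From mathcomp Require Import complex.
From mathcomp Require Import all_classical all_reals all_analysis.
From mathcomp Require Import ring lra.
Set Implicit Arguments.
Unset Strict Implicit.
Unset Printing Implicit Defensive.
Import Order.TTheory GRing.Theory Num.Theory.
Import numFieldNormedType.Exports.
Local Open Scope classical_set_scope.
Local Open Scope ring_scope.

(** * Sublinear functionals and the real Hahn-Banach theorem *)

Section Sublinear.
Variables (R : realType) (V : lmodType R).
Implicit Types (p q : V -> R) (x y : V).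

(** Homogeneity is asked as an inequality, the form that passes directly to infima; scaling back by
    [t^-1] recovers equality. *)
Definition sublinear p :=
  (forall x y, p (x + y) <= p x + p y) /\
  (forall t x, 0 < t -> p (t *: x) <= t * p x).

Lemma sublinear0 p : sublinear p -> p 0 = 0.
Proof.
(* Subadditivity gives [0 <= p 0], and halving gives [p 0 <= p 0 / 2]. *)
case=> [pD pZ]; have := pD 0 0; rewrite addr0.
have := pZ 2^-1 0; rewrite scaler0 invr_gt0 ltr0n => /(_ isT).
by lra.
Qed.

Lemma sublinearN p x : sublinear p -> - p (- x) <= p x.
Proof.
move=> sp; have [pD _] := sp; have := pD x (- x).
by rewrite subrr sublinear0//; lra.
Qed.

Lemma sublinearZ p t x : sublinear p -> 0 <= t -> p (t *: x) = t * p x.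
Proof.
move=> sp; rewrite le_eqVlt => /predU1P[<-|t0].
  by rewrite scale0r mul0r sublinear0.
have [_ pZ] := sp; apply/eqP; rewrite eq_le pZ//=.
have := pZ t^-1 (t *: x); rewrite invr_gt0 => /(_ t0).
by rewrite scalerA mulVf ?gt_eqF// scale1r mulrC ler_pdivlMr// mulrC.
Qed.

(** Serves both for [ray_inf], where parameters add up, and for the infimum of a chain, where the
    smaller of two members provides [c]. *)
Lemma sublinear_inf (G : V -> set R) :
  (forall x, G x !=set0) -> (forall x, has_lbound (G x)) ->
  (forall x y a b, G x a -> G y b -> exists2 c, G (x + y) c & c <= a + b) ->
  (forall t x a, 0 < t -> G x a -> G (t *: x) (t * a)) ->
  sublinear (fun x => inf (G x)).
Proof.
move=> G0 Glb GD GZ; split=> [x y|t x t0].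
  rewrite -lerBlDr; apply: lb_le_inf => // a Ga; rewrite lerBlDr -lerBlDl.
  apply: lb_le_inf => // b Gb; rewrite lerBlDl.
  by have [c Gc ca] := GD _ _ _ _ Ga Gb; rewrite (le_trans _ ca)// ge_inf.
rewrite mulrC -ler_pdivrMr//; apply: lb_le_inf => // a Ga.
by rewrite ler_pdivrMr// mulrC ge_inf//; exact: GZ.
Qed.

(** For sublinear [p], this is the greatest sublinear [q <= p] with [q (- y) <= - p y]. *)
Definition ray_inf p y x :=
  inf [set p (x + t *: y) - t * p y | t in [set t | 0 <= t]].

Lemma ray_has_lbound p x y : sublinear p ->
  has_lbound [set p (x + t *: y) - t * p y | t in [set t | 0 <= t]].
Proof.
move=> sp; have [pD _] := sp; exists (- p (- x)) => _ [s s0 <-].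
have := pD (x + s *: y) (- x).
by rewrite addrC addrA addNr add0r sublinearZ//; lra.
Qed.

Lemma ray_inf_le p x y t : sublinear p -> 0 <= t ->
  ray_inf p y x <= p (x + t *: y) - t * p y.
Proof.
by move=> sp t0; apply: ge_inf; [exact: ray_has_lbound | exists t].
Qed.

Lemma ray_inf_sublinear p y : sublinear p -> sublinear (ray_inf p y).
Proof.
move=> sp; have [pD pZ] := sp; apply: sublinear_inf.
- by move=> x; exists (p (x + 0 *: y) - 0 * p y); exists 0 => /=.
- by move=> x; exact: ray_has_lbound.
- move=> x z _ _ [s /= s0 <-] [t /= t0 <-].
  exists (p (x + z + (s + t) *: y) - (s + t) * p y).
    by exists (s + t); rewrite //= addr_ge0.
  by rewrite scalerDl addrACA; have := pD (x + s *: y) (z + t *: y); lra.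
- move=> t x _ t0 [s /= s0 <-]; exists (t * s); first by rewrite /= mulr_ge0// ltW.
  by rewrite -scalerA -scalerDr sublinearZ ?ltW// mulrBr mulrA.
Qed.

(** Zorn's lemma for the reversed pointwise order. A chain is bounded by its pointwise infimum,
    which is finite because each member satisfies [- p (- x) <= - q (- x) <= q x]. *)
Lemma minimal_sublinear p : sublinear p ->
  exists2 q, sublinear q /\ (forall x, q x <= p x) &
    forall r, sublinear r -> (forall x, r x <= q x) -> forall x, q x <= r x.
Proof.
move=> sp; pose T := {q | sublinear q /\ (forall x, q x <= p x)}.
pose below (q r : T) := `[< forall x, sval r x <= sval q x >].
have p0 : T by exists p.
have [|||[q [sq qp]] qmin] := @ZL_preorder T p0 below.
- by move=> q; apply/asboolP.
- move=> q r s /asboolP qr /asboolP rs; apply/asboolP => x.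
  exact: le_trans (rs x) (qr x).
- move=> A Atot; have [->|/set0P[q0 Aq0]] := eqVneq A set0; first by exists p0.
  pose G x := [set sval q x | q in A].
  have Glb x : has_lbound (G x).
    exists (- p (- x)) => _ [[q [sq qp]] Aq <-] /=.
    by rewrite (le_trans _ (sublinearN x sq))// lerN2.
  have Ginf (q : T) x : A q -> inf (G x) <= sval q x.
    by move=> Aq; apply: ge_inf => //; exists q.
  have sG : sublinear (fun x => inf (G x)).
    apply: sublinear_inf => //.
    + by move=> x; exists (sval q0 x); exists q0.
    + move=> x y _ _ [q Aq <-] [r Ar <-].
      have [/asboolP qr|/asboolP rq] := Atot _ _ Aq Ar.
        exists (sval r (x + y)); first by exists r.
        by have [/(_ x y) + _] := (svalP r).1; have := qr x; lra.
      exists (sval q (x + y)); first by exists q.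
      by have [/(_ x y) + _] := (svalP q).1; have := rq y; lra.
    + move=> t x _ t0 [q Aq <-]; exists q => //.
      by rewrite sublinearZ ?ltW//; case: (svalP q).
  have Gp x : inf (G x) <= p x.
    exact: le_trans (Ginf _ x Aq0) ((svalP q0).2 x).
  exists (exist _ (fun x => inf (G x)) (conj sG Gp) : T) => q Aq.
  by apply/asboolP => x; exact: Ginf.
exists q; first by [].
move=> r sr rq; have rp x : r x <= p x by exact: le_trans (rq x) (qp x).
suff /qmin/asboolP :
  below (exist _ q (conj sq qp)) (exist _ r (conj sr rp)) by [].
exact/asboolP.
Qed.

(* [ray_inf q y] is sublinear and at most [q], so minimality gives
   [q x <= q (x + y) - q y]. *)
Lemma minimal_sublinear_linear q : sublinear q ->
    (forall r, sublinear r -> (forall x, r x <= q x) -> forall x, q x <= r x) ->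
  scalar q.
Proof.
move=> sq qmin.
have qD x y : q (x + y) = q x + q y.
  apply/eqP; rewrite eq_le sq.1/= -lerBrDr.
  apply: le_trans (qmin _ (ray_inf_sublinear y sq) _ x) _ => [z|].
    have := @ray_inf_le q z y 0 sq.
    by rewrite scale0r addr0 mul0r subr0; apply.
  have := @ray_inf_le q x y 1 sq.
  by rewrite scale1r mul1r; apply.
have qN x : q (- x) = - q x.
  by apply/eqP; rewrite -addr_eq0 -qD addNr sublinear0.
move=> a x y; rewrite qD; congr (_ + _).
have [a0|/ltW a0] := leP 0 a; first exact: sublinearZ.
by rewrite -[a]opprK scaleNr qN sublinearZ ?oppr_ge0// !mulNr.
Qed.

(* Starting from [ray_inf p v], whose value at [- v] is at most [- p v], forces
   [f v = p v]. *)
Theorem hahn_banach p v : sublinear p ->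
  exists f : V -> R, [/\ scalar f, forall x, f x <= p x & f v = p v].
Proof.
move=> sp; have [q [sq qr] qmin] := minimal_sublinear (ray_inf_sublinear v sp).
have lq := minimal_sublinear_linear sq qmin.
have qp x : q x <= p x.
  rewrite (le_trans (qr x))//; have := @ray_inf_le p x v 0 sp.
  by rewrite scale0r addr0 mul0r subr0; apply.
exists q; split => //; apply/eqP; rewrite eq_le qp/=.
have := @ray_inf_le p (- v) v 1 sp ler01; have := qr (- v).
rewrite scale1r mul1r addNr sublinear0// => {}qr.
by have := lq (-1) v 0; rewrite !addr0 (sublinear0 sq) scaleN1r; lra.
Qed.

End Sublinear.

(** * Passage to complex scalars and separation by bounded functionals *)

(* A copy of a complex vector space on which only real scalars act. *)
Definition realify (R : realType) (V : Type) : Type := V.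

Section Realify.
Variables (R : realType) (V : lmodType R[i]).

HB.instance Definition _ := GRing.Zmodule.on (realify R V).

Definition realify_scale (a : R) (x : realify R V) : realify R V :=
  a%:C%C *: (x : V).

Fact realify_scaleA a b x :
  realify_scale a (realify_scale b x) = realify_scale (a * b) x.
Proof. by rewrite /realify_scale scalerA rmorphM. Qed.

Fact realify_scale1 : left_id 1 realify_scale.
Proof. by move=> x; rewrite /realify_scale rmorph1 scale1r. Qed.

Fact realify_scaleDr : right_distributive realify_scale +%R.
Proof. by move=> a x y; rewrite /realify_scale scalerDr. Qed.

Fact realify_scaleDl x : {morph realify_scale^~ x : a b / a + b}.
Proof. by move=> a b; rewrite /realify_scale rmorphD scalerDl. Qed.

HB.instance Definition _ := GRing.Zmodule_isLmodule.Build R (realify R V)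
  realify_scaleA realify_scale1 realify_scaleDr realify_scaleDl.

End Realify.

Lemma normci (R : rcfType) : `|'i%C : R[i]| = 1.
Proof. by rewrite normc_def/= expr0n expr1n add0r sqrtr1. Qed.

Lemma normc_le_ReIm (R : realType) (a b : R) :
  `|(a +i* b)%C| <= (`|a| + `|b|)%:C%C.
Proof.
have -> : (a +i* b)%C = a%:C%C + 'i%C * b%:C%C by rewrite [LHS]complexE.
rewrite (le_trans (ler_normD _ _))// normrM normci mul1r !normc_def/=.
by rewrite expr0n /= !addr0 !sqrtr_sqr rmorphD.
Qed.

(** Hahn-Banach for the norm on the underlying real space gives a real functional equal to the norm
    at [v]; it is then complexified and rescaled. *)
Lemma dual_separates (R : realType) (X : normedModType R[i]) (v : X) :
  v != 0 -> exists phi : dual X, phi v = 1 :> R[i].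
Proof.
move=> v0; pose p (x : realify R X) : R := complex.Re `|x : X|.
have normE (x : X) : `|x| = (p x)%:C%C.
  by rewrite RRe_real// normr_real.
have sp : sublinear p.
  split=> [x y|t x t0].
    by rewrite -lecR rmorphD /= -!normE; exact: (ler_normD (x : X) y).
  rewrite -lecR rmorphM /= -!normE [X in X <= _](normrZ _ (x : X)).
  by rewrite ger0_norm// ler0c ltW.
have [f [lf fp fv]] := hahn_banach (v : realify R X) sp.
have f0 : f 0 = 0 by have := lf 1 0 0; rewrite scaler0 addr0; lra.
have fD x y : f (x + y) = f x + f y.
  by have := lf 1 x y; rewrite scale1r mul1r.
have fZ (a : R) (x : X) : f (a%:C%C *: x) = a * f x.
  by have := lf a x 0; rewrite f0 !addr0.
have fN (x : X) : f (- x) = - f x.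
  by have := fZ (-1) x; rewrite rmorphN rmorph1 scaleN1r mulN1r.
have f_le (x : X) : `|f x| <= p x.
  rewrite ler_norml fp andbT lerNl -fN (le_trans (fp _))//.
  by rewrite -lecR -!normE normrN.
(* The only complex linear functional with real part [f]. *)
pose phi (x : X) : R[i] := (f x -i* f ('i%C *: x))%C.
have phi_lin : linear (phi : X -> R[i]^o).
  move=> c x y; rewrite /phi scalerDr !fD.
  case: c => a b.
  have c1 : (a +i* b)%C = a%:C%C + b%:C%C * 'i%C.
    by apply/eqP; rewrite eq_complex/=; apply/andP; split; apply/eqP; ring.
  have c2 : 'i%C * (a +i* b)%C = (- b)%:C%C + a%:C%C * 'i%C.
    by apply/eqP; rewrite eq_complex/=; apply/andP; split; apply/eqP; ring.
  have e1 : f ((a +i* b)%C *: x) = a * f x + b * f ('i%C *: x).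
    by rewrite c1 scalerDl fD -scalerA !fZ.
  have e2 : f ('i%C *: ((a +i* b)%C *: x)) = a * f ('i%C *: x) - b * f x.
    by rewrite scalerA c2 scalerDl fD -scalerA !fZ mulNr addrC.
  rewrite e1 e2; apply/eqP; rewrite eq_complex/=.
  by apply/andP; split; apply/eqP; ring.
have phi_bl : phi \in @bounded_linear R[i] X R[i]^o.
  (* Real and imaginary parts are each at most the norm of [x], hence the constant 2. *)
  apply/bounded_linearP; split=> //; exists 2 => x.
  rewrite (le_trans (normc_le_ReIm _ _))// normrN.
  rewrite [X in X *: x]/= normE -[2]/(1 + 1) mulrDl !mul1r -rmorphD lecR.
  rewrite lerD ?f_le// (le_trans (f_le _))// -lecR -!normE.
  by rewrite normrZ normci mul1r.
have phiv0 : phi v != 0.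
  rewrite eq_complex/= negb_and fv; apply/orP; left.
  by apply: contraNneq v0 => pv0; rewrite -normr_eq0 normE pv0.
exists ((phi v)^-1 *: (BoundedLinear phi_bl : dual X)).
exact: mulVf.
Qed.

(** * Independence and dimension for at most two vectors *)

Section SmallDimension.
Variables (K : fieldType) (V : lmodType K).
Implicit Types (u v : V) (S : set V).

Lemma lin_indep1P v : lin_indep [tuple v] <-> v != 0.
Proof.
split=> [iv|v0 a].
  apply/eqP => v0; have /eqP : 1 = 0 :> K.
    by apply: (iv (fun=> 1) _ ord0); rewrite big_ord1/= v0 scaler0.
  by rewrite oner_eq0.
rewrite big_ord1/= => /eqP; rewrite scaler_eq0 (negPf v0) orbF => /eqP a0 i.
by rewrite (ord1 i).
Qed.

Lemma lin_indep2P u v : lin_indep [tuple u; v] <->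
  forall a b, a *: u + b *: v = 0 -> a = 0 /\ b = 0.
Proof.
split=> [iuv a b ab0|iuv a].
  have := iuv (fun i => if i == ord0 then a else b).
  rewrite !big_ord_recl big_ord0/= addr0 => /(_ ab0) c0.
  by split; [exact: (c0 ord0) | exact: (c0 (lift ord0 ord0))].
rewrite !big_ord_recl big_ord0/= addr0 => /iuv[a0 a1] i.
by case: (unliftP ord0 i) => [j ->|-> //]; rewrite (ord1 j).
Qed.

Lemma lin_dep2P u v : u != 0 -> lin_dep [tuple u; v] ->
  exists c, v = c *: u.
Proof.
move=> u0 duv; apply: contrapT => nc; apply: duv; apply/lin_indep2P => a b ab0.
have b0 : b = 0.
  apply/eqP/negPn/negP => b0; apply: nc; exists (- b^-1 * a).
  rewrite -scalerA (_ : a *: u = - (b *: v)); last first.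
    by apply/eqP; rewrite -addr_eq0 ab0.
  by rewrite scalerN scaleNr opprK scalerA mulVf// scale1r.
split=> //; move/eqP: ab0; rewrite b0 scale0r addr0 scaler_eq0 (negPf u0) orbF.
by move/eqP.
Qed.

Lemma lin_indep2C u v : lin_indep [tuple u; v] -> lin_indep [tuple v; u].
Proof.
move=> /lin_indep2P iuv; apply/lin_indep2P => a b.
by rewrite addrC => /iuv[].
Qed.

Lemma lin_indep2_neq0 u v : lin_indep [tuple u; v] -> u != 0 /\ v != 0.
Proof.
move/lin_indep2P => iuv; split; apply/eqP => w0.
  have [] := iuv 1 0; first by rewrite w0 scaler0 scale0r addr0.
  by move/eqP; rewrite oner_eq0.
have [] := iuv 0 1; first by rewrite w0 scaler0 scale0r addr0.
by move=> _ /eqP; rewrite oner_eq0.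
Qed.

Lemma has_dim0 S : has_dim S 0 -> S = [set 0].
Proof.
case=> e [_ ->]; apply/seteqP; split=> v /=; first by case=> a ->; rewrite big_ord0.
by move=> ->; exists (fun=> 0); rewrite big_ord0.
Qed.

Lemma has_dim1P S :
  has_dim S 1 <-> exists2 v, v != 0 & S = [set a *: v | a in [set: K]].
Proof.
split=> [[e [ie ->]]|[v v0 ->]].
  case/tupleP: e ie => v e; rewrite (tuple0 e) => /lin_indep1P v0.
  exists v => //; apply/seteqP; split=> [z [a ->]|z [a _ <-]].
    by exists (a ord0); rewrite // big_ord1.
  by exists (fun=> a); rewrite big_ord1.
exists [tuple v]; split; first exact/lin_indep1P.
apply/seteqP; split=> [z [a _ <-]|z [a ->]].
  by exists (fun=> a); rewrite big_ord1.
by exists (a ord0); rewrite // big_ord1.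
Qed.

End SmallDimension.

(** * Rank one operators and their fixed spaces *)

Section RankOne.
Variables (K : numFieldType) (X : normedModType K).
Implicit Types (A B S T : 'B(X)) (x y z : X) (f g h : dual X).

Lemma bl_eqP (V W : normedModType K) (F G : boundedLinear V W) : F =1 G -> F = G.
Proof. by move=> FG; apply: val_inj; apply/funext. Qed.

Lemma bl_neq0 (V W : normedModType K) (F : boundedLinear V W) :
  F != 0 -> exists v, F v != 0.
Proof.
move=> F0; apply: contrapT => nF; move/eqP: F0; apply; apply: bl_eqP => v.
by apply/eqP/negPn/negP => Fv; apply: nF; exists v.
Qed.

(* [linearZ] and [linearD] leave the value of a functional in the regular
   module [K^o], out of reach of the ring lemmas of [K]. *)
Lemma dualZ f a z : f (a *: z) = a * f z :> K.
Proof. exact: linearZ. Qed.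

Lemma dualD f y z : f (y + z) = f y + f z :> K.
Proof. exact: linearD. Qed.

Lemma dualB f y z : f (y - z) = f y - f z :> K.
Proof. exact: linearB. Qed.

Lemma dual_neq0 f : f != 0 -> exists z, f z = 1 :> K.
Proof.
move=> /bl_neq0[z fz]; exists (((f z : K)^-1) *: z).
by rewrite dualZ mulVf.
Qed.

Lemma blDE (V W : normedModType K) (F G : boundedLinear V W) v :
  (F + G) v = F v + G v.
Proof. by []. Qed.

Lemma blZE (V W : normedModType K) a (F : boundedLinear V W) v :
  (a *: F) v = a *: F v.
Proof. by []. Qed.

Lemma tensorE x f z : tensor x f z = (f z : K) *: x.
Proof. by []. Qed.

Lemma tensor_neq0 x f : tensor x f != 0 -> x != 0 /\ f != 0.
Proof.
move=> xf; split; apply: contraNneq xf => ->; apply/eqP/bl_eqP => z.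
  by rewrite tensorE scaler0.
exact: scale0r.
Qed.

Lemma tensorDl x y f : tensor x f + tensor y f = tensor (x + y) f.
Proof. by apply: bl_eqP => z; rewrite blDE !tensorE scalerDr. Qed.

Lemma tensorDr x f g : tensor x f + tensor x g = tensor x (f + g).
Proof. by apply: bl_eqP => z; rewrite blDE !tensorE blDE scalerDl. Qed.

Lemma tensorZl a x f : a *: tensor x f = tensor (a *: x) f.
Proof. by apply: bl_eqP => z; rewrite blZE !tensorE !scalerA mulrC. Qed.

Lemma tensorZr a x f : a *: tensor x f = tensor x (a *: f).
Proof. by apply: bl_eqP => z; rewrite blZE !tensorE blZE scalerA. Qed.

Lemma has_rank1_tensor x f : tensor x f != 0 -> has_rank (tensor x f) 1.
Proof.
move=> /tensor_neq0[x0 /dual_neq0[z fz]]; apply/has_dim1P; exists x => //.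
apply/seteqP; split=> [_ [w _ <-]|_ [a _ <-]]; first by exists (f w : K).
by exists (a *: z); rewrite //= dualZ fz mulr1.
Qed.

(** The functional is the coordinate of [A z] along a vector [x] spanning the range: uniqueness of
    coordinates makes it linear, and the bound of [A] divided by the norm of [x] bounds it. *)
Lemma has_rank1P A : has_rank A 1 ->
  exists x f, [/\ x != 0, f != 0 & A = tensor x f].
Proof.
case/has_dim1P => x x0 rA.
have /choice[c cE] z : exists c : K, A z = c *: x.
  have : range A (A z) by exists z.
  by rewrite rA => -[c _ <-]; exists c.
have cI a b : a *: x = b *: x -> a = b.
  move=> /eqP; rewrite -subr_eq0 -scalerBl scaler_eq0 (negPf x0) orbF subr_eq0.
  by move/eqP.
have c_bl : (c : X -> K^o) \in @bounded_linear K X K^o.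
  apply/bounded_linearP; split=> [a y z|].
    by apply: cI; rewrite -cE linearP/= !cE scalerDl scalerA.
  have /bounded_linearP[_ [M AM]] := bl_funP A.
  exists (M / `|x|) => z; rewrite mulrAC ler_pdivlMr ?normr_gt0//.
  by rewrite -normrZ -cE.
exists x, (BoundedLinear c_bl); split=> //; last by apply: bl_eqP => z /=.
apply/eqP => c0.
have [z _ Az] : range A x by rewrite rA; exists 1; rewrite ?scale1r.
move/eqP: x0; apply; rewrite -Az cE.
by have -> : c z = (BoundedLinear c_bl) z by []; rewrite c0 scale0r.
Qed.

Lemma rank_le1_neq0 A : rank_le1 A -> A != 0 -> has_rank A 1.
Proof.
move=> [[|[|//]] _ // /has_dim0 rA] /bl_neq0[z]; have : range A (A z) by exists z.
by rewrite rA => -> /eqP.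
Qed.

(* [z = f (T z) x] forces [f (T z) = f (T z) * f (T x)]. *)
Lemma fixed_space_dim1P x f T : x != 0 ->
  has_dim (fixed_space (opcomp (tensor x f) T)) 1 <-> f (T x) = 1 :> K.
Proof.
move=> x0; split=> [/has_dim1P[z z0 Fz]|fTx].
  have : fixed_space (opcomp (tensor x f) T) z.
    by rewrite Fz; exists 1; rewrite ?scale1r.
  rewrite /fixed_space/= => zE; set c : K := f (T z) in zE.
  have c0 : c != 0 by apply: contraNneq z0 => c0; rewrite -zE c0 scale0r.
  have : c * f (T x) = c * 1.
    by rewrite mulr1 [in RHS]/c -zE linearZ dualZ.
  exact: mulfI.
apply/has_dim1P; exists x => //; apply/seteqP; split=> [z <-|z [a _ <-]].
  by exists (f (T z) : K).
by rewrite /fixed_space/= linearZ dualZ fTx mulr1.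
Qed.

(** Used twice, with [f] and [g] exchanged, it yields vectors dual to the two functionals. *)
Lemma dual_indep f g : lin_indep [tuple f; g] ->
  exists z, f z = 1 :> K /\ g z = 0 :> K.
Proof.
move=> ifg; have [_ /dual_neq0[w gw]] := lin_indep2_neq0 ifg.
have [z] : exists z, (f z : K) - g z * f w != 0.
  have /bl_neq0[z fz] : f - (f w : K) *: g != 0.
    apply/eqP => fg; move/lin_indep2P: ifg => /(_ 1 (- (f w : K))).
    by rewrite scale1r scaleNr fg => /(_ erefl)[/eqP]; rewrite oner_eq0.
  by exists z; rewrite mulrC.
set c : K := _ - _ => c0.
(* As [g w = 1], the subtraction kills [g]; it leaves [f] with the value [c]. *)
exists (c^-1 *: (z - (g z : K) *: w)); split.
  by rewrite dualZ dualB dualZ mulVf.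
by rewrite dualZ dualB dualZ gw mulr1 subrr mulr0.
Qed.

Lemma midpoint_indep (V : lmodType K) (u v : V) : lin_indep [tuple u; v] ->
  lin_indep [tuple 2^-1 *: (u + v); u] /\ lin_indep [tuple 2^-1 *: (u + v); v].
Proof.
move=> /lin_indep2P iuv; have half0 : 2^-1 != 0 :> K by rewrite invr_eq0 pnatr_eq0.
split; apply/lin_indep2P => a b ab0.
  have [|/eqP] := iuv (a / 2 + b) (a / 2).
    by rewrite -[RHS]ab0 scalerA scalerDr scalerDl addrAC.
  move=> + /eqP; rewrite mulf_eq0 (negPf half0) orbF => + /eqP a0.
  by rewrite a0 mul0r add0r => /eqP.
have [|+ /eqP] := iuv (a / 2) (a / 2 + b).
  by rewrite -[RHS]ab0 scalerA scalerDr scalerDl addrA.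
move=> /eqP; rewrite mulf_eq0 (negPf half0) orbF => /eqP a0.
by rewrite a0 mul0r add0r => /eqP.
Qed.

(** Moving a scalar across the tensor makes the shared factor literally equal, so the sum is again a
    tensor; the weights add up to 1, so the condition of value 1 survives averaging. *)
Lemma op_sim_midpoint A B :
  op_sim A B -> A != 0 -> B != 0 -> 2^-1 *: (A + B) != 0 ->
  rank_le1 (2^-1 *: (A + B)) /\
  forall T,
    has_dim (fixed_space (opcomp A T)) 1 /\ has_dim (fixed_space (opcomp B T)) 1 ->
    has_dim (fixed_space (opcomp (2^-1 *: (A + B)) T)) 1.
Proof.
have half2 : 2^-1 * (1 + 1) = 1 :> K by rewrite mulVf// pnatr_eq0.
move=> [x [f [y [g [-> -> dep]]]]] /tensor_neq0[x0 f0] B0 S0.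
case: dep => [/(lin_dep2P x0)[c yE]|/(lin_dep2P f0)[c gE]].
  have SE : 2^-1 *: (tensor x f + tensor y g) =
            tensor x (2^-1 *: (f + c *: g)).
    by rewrite yE -tensorZl tensorZr tensorDr tensorZr.
  rewrite SE in S0 *; split; first by exists 1%N => //; exact: has_rank1_tensor.
  rewrite yE -tensorZl tensorZr => T [/(fixed_space_dim1P _ _ x0) fT].
  move=> /(fixed_space_dim1P _ _ x0) gT; apply/(fixed_space_dim1P _ _ x0).
  by rewrite blZE blDE fT gT; exact: half2.
have SE : 2^-1 *: (tensor x f + tensor y g) =
          tensor (2^-1 *: (x + c *: y)) f.
  by rewrite gE -tensorZr tensorZl tensorDl tensorZl.
have BE : tensor y g = tensor (c *: y) f by rewrite gE -tensorZr tensorZl.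
rewrite BE in B0; have [y0 _] := tensor_neq0 B0.
rewrite SE in S0 *; have [s0 _] := tensor_neq0 S0.
split; first by exists 1%N => //; exact: has_rank1_tensor.
rewrite BE => T [/(fixed_space_dim1P _ _ x0) fx /(fixed_space_dim1P _ _ y0) fy].
apply/(fixed_space_dim1P _ _ s0).
by rewrite linearZ linearD dualZ dualD fx fy.
Qed.

End RankOne.

(** * Recovering an operator from its test condition *)

Section Separation.
Variables (R : realType) (X : normedModType R[i]).
Implicit Types (x y u : X) (f g h : dual X).

Lemma tensor_affine_comb x y u f g h :
    x != 0 -> y != 0 -> lin_indep [tuple f; g] ->
    (forall T : 'B(X), f (T x) = 1 :> R[i] -> g (T y) = 1 :> R[i] ->
       h (T u) = 1 :> R[i]) ->
  exists a b, tensor u h = a *: tensor x f + b *: tensor y g.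
Proof.
move=> x0 y0 ifg hT.
have [w1 [fw1 gw1]] := dual_indep ifg.
have [w2 [gw2 fw2]] := dual_indep (lin_indep2C ifg).
have [phi phix] := dual_separates x0; have [psi psiy] := dual_separates y0.
(* [f (T x) = g (T y) = 1] for [T = T1 + T2], so [h (N u) = 0] whenever
   [f (N x) = g (N y) = 0]. *)
pose T1 := tensor w1 phi; pose T2 := tensor w2 psi.
have T1E v : T1 v = (phi v : R[i]) *: w1 by [].
have T2E v : T2 v = (psi v : R[i]) *: w2 by [].
have hT0 (N : 'B(X)) : f (N x) = 0 :> R[i] -> g (N y) = 0 :> R[i] ->
    h (N u) = 0 :> R[i].
  move=> fN gN; have h0 : h ((T1 + T2) u) = 1 :> R[i].
    apply: hT; rewrite blDE T1E T2E dualD !dualZ.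
      by rewrite phix fw1 fw2 mulr0 addr0 mulr1.
    by rewrite psiy gw1 gw2 mulr0 add0r mulr1.
  have : h ((T1 + T2 + N) u) = 1 :> R[i].
    apply: hT; rewrite !blDE T1E T2E !dualD !dualZ.
      by rewrite phix fw1 fw2 fN mulr0 !addr0 mulr1.
    by rewrite psiy gw1 gw2 gN mulr0 add0r addr0 mulr1.
  rewrite blDE dualD h0 => /eqP.
  by rewrite addrC -subr_eq0 addrK => /eqP.
(* [T1] and [T2] are dual to the functionals [f (N x)] and [g (N y)] of [N], so these are the only
   possible values of the coefficients. If the identity fails at [z], some [theta] takes the value 1
   on the difference. *)
exists (h (T1 u) : R[i]), (h (T2 u) : R[i]); apply: bl_eqP => z.
apply/eqP; rewrite -subr_eq0; apply/negPn/negP => /dual_separates[theta].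
rewrite blDE !blZE !tensorE dualB dualD !dualZ => thetaz.
(* Correcting [tensor z theta] by [T1] and [T2] makes both conditions vanish, while [h (N u)]
   becomes [theta] of the difference, that is 1. *)
pose N := tensor z theta - (f z * theta x : R[i]) *: T1
          - (g z * theta y : R[i]) *: T2.
have NE v : N v = (theta v : R[i]) *: z - (f z * theta x : R[i]) *: T1 v
          - (g z * theta y : R[i]) *: T2 v by [].
have /hT0 : f (N x) = 0 :> R[i].
  by rewrite NE T1E T2E !dualB !dualZ fw1 fw2 phix; ring.
have /[swap]/[apply] : g (N y) = 0 :> R[i].
  by rewrite NE T1E T2E !dualB !dualZ gw1 gw2 psiy; ring.
rewrite NE T1E T2E !dualB !dualZ => hN.
move/eqP: (oner_neq0 R[i]); apply; rewrite -thetaz -[RHS]hN.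
ring.
Qed.

End Separation.

Theorem lemma2p7 (R : realType) (X : completeNormedModType R[i])
    (A B : 'B(X)) :
  infinite_dimensional X ->
  has_rank A 1 -> has_rank B 1 -> lin_indep [tuple A; B] ->
  (op_sim A B <->
  exists S : 'B(X),
    [/\ rank_le1 S,
        lin_indep [tuple S; A],
        lin_indep [tuple S; B] &
        forall T : 'B(X),
          has_dim (fixed_space (opcomp A T)) 1 /\
          has_dim (fixed_space (opcomp B T)) 1 ->
          has_dim (fixed_space (opcomp S T)) 1]).
Proof.
move=> _ rA rB iAB; split.
  move=> sAB; have [A0 B0] := lin_indep2_neq0 iAB.
  have [iSA iSB] := midpoint_indep iAB; have [S0 _] := lin_indep2_neq0 iSA.
  have [rS fS] := op_sim_midpoint sAB A0 B0 S0.
  by exists (2^-1 *: (A + B)).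
case=> S [rS iSA iSB hT].
have [x [f [x0 f0 AE]]] := has_rank1P rA; have [y [g [y0 g0 BE]]] := has_rank1P rB.
exists x, f, y, g; split=> //.
apply: contrapT => /not_orP[/contrapT ixy /contrapT ifg].
have [S0 _] := lin_indep2_neq0 iSA.
have [u [h [u0 h0 SE]]] := has_rank1P (rank_le1_neq0 rS S0).
have [T fT gT|a [b abE]] := @tensor_affine_comb _ _ x y u f g h x0 y0 ifg.
  apply/(fixed_space_dim1P h T u0); rewrite -SE; apply: hT.
  by rewrite AE BE; split; apply/fixed_space_dim1P.
(* Otherwise [S] would be a multiple of [B]; likewise [b = 0] would make it a multiple of [A]. *)
have a0 : a != 0.
  apply/eqP => a0; move/lin_indep2P: iSB => /(_ 1 (- b)).
  rewrite scale1r scaleNr SE abE a0 scale0r add0r -BE subrr => /(_ erefl)[/eqP].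
  by rewrite oner_eq0.
have b0 : b != 0.
  apply/eqP => b0; move/lin_indep2P: iSA => /(_ 1 (- a)).
  rewrite scale1r scaleNr SE abE b0 scale0r addr0 -AE subrr => /(_ erefl)[/eqP].
  by rewrite oner_eq0.
have [w1 [fw1 gw1]] := dual_indep ifg.
have [w2 [gw2 fw2]] := dual_indep (lin_indep2C ifg).
(* Evaluation at the dual vectors puts [a *: x] and [b *: y] on the line of [u]. *)
have e1 : (h w1 : R[i]) *: u = a *: x.
  have : tensor u h w1 = (a *: tensor x f + b *: tensor y g) w1 by rewrite abE.
  rewrite blDE !blZE !tensorE fw1 gw1.
  by rewrite scale1r scale0r scaler0 addr0.
have e2 : (h w2 : R[i]) *: u = b *: y.
  have : tensor u h w2 = (a *: tensor x f + b *: tensor y g) w2 by rewrite abE.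
  rewrite blDE !blZE !tensorE fw2 gw2.
  by rewrite scale1r scale0r scaler0 add0r.
(* Both terms equal [h w1 * h w2] times [u] up to sign and cancel; independence forces [h w2 = 0],
   hence [b *: y = 0], a contradiction. *)
move/lin_indep2P: ixy => /(_ ((h w2 : R[i]) * a) (- ((h w1 : R[i]) * b))).
rewrite scaleNr -!scalerA -e1 -e2 !scalerA mulrC subrr => /(_ erefl)[/eqP + _].
rewrite mulf_eq0 (negPf a0) orbF => /eqP hw2.
by move/eqP: e2; rewrite hw2 scale0r eq_sym scaler_eq0 (negPf b0) (negPf y0).
Qed.
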